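(* For every binary stiffened-gas mixture state (with all quantities as defined in the context), the discriminant $d=b^2+4c$ satisfies $$d=(b_1-b_2)^2+4a_1a_2,$$ where $a_k=\sigma^{(k)}(\rho(\varepsilon-\varepsilon_0)-p_{*k})$ and $b_k=a_k-p_{*k}$, $k=1,2$, and also $$d=\big[(\alpha_2\sigma^{(1)}-\alpha_1\sigma^{(2)})^2+2(\alpha_1\sigma^{(2)}+\alpha_2\sigma^{(1)})+1\big]\Delta_*^2 +2c_V\rho\theta\big[(\alpha_2\sigma^{(1)}-\alpha_1\sigma^{(2)})(\gamma-1)+\sigma^{(1)}-\sigma^{(2)}\big]\Delta_* +((\gamma-1)c_V\rho\theta)^2>0,$$ where $\Delta_*=p_{*2}-p_{*1}$ (so that $d$ is represented as a quadratic polynomial with respect to $\Delta_*$).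
   Context: $\langle\cdot\rangle$ denotes summation over $k=1,2$. Physical constants for $k=1,2$: $c_{Vk}>0$, $\gamma_k>1$, $R_k=(\gamma_k-1)c_{Vk}>0$, $p_{*k}\geq 0$, $\varepsilon_{0k}\in\mathbb{R}$. A binary stiffened-gas mixture state consists of component densities $r_k>0$, volume fractions $0<\alpha_k<1$ ($k=1,2$) and a temperature $\theta>0$ such that $\alpha_1+\alpha_2=1$ and the component pressures $p_k=R_kr_k\theta-p_{*k}$ are equal to a common pressure: $p=p_1=p_2>0$. The component specific internal energies are $\varepsilon_k=c_{Vk}\theta+p_{*k}/r_k+\varepsilon_{0k}$. Put $\rho_k=\alpha_kr_k$, $\rho=\langle\rho_k\rangle$, and define $\varepsilon,\varepsilon_0,R,c_V,\gamma$ by $\rho\varepsilon=\langle\rho_k\varepsilon_k\rangle$, $\rho\varepsilon_0=\langle\rho_k\varepsilon_{0k}\rangle$, $\rho R=\langle R_k\rho_k\rangle$, $\rho c_V=\langle c_{Vk}\rho_k\rangle$, $\gamma=R/c_V+1$. Put $\sigma^{(k)}=\dfrac{R_k\rho_k}{c_V\rho}$ and $$b=\langle\sigma^{(k)}(\rho(\varepsilon-\varepsilon_0)-p_{*k})-p_{*k}\rangle,\qquad c=(\sigma^{(1)}p_{*2}+\sigma^{(2)}p_{*1})\rho(\varepsilon-\varepsilon_0)-\gamma p_{*1}p_{*2},\qquad d=b^2+4c.$$ The common pressure $p$ satisfies the quadratic equation $p^2-bp-c=0$, whose discriminant is $d$. *)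

(* Defs.v *)
From mathcomp Require Import all_boot all_order all_algebra.
From mathcomp Require Import reals.

Set Implicit Arguments.
Unset Strict Implicit.
Unset Printing Implicit Defensive.

Import Order.TTheory GRing.Theory Num.Theory.
Local Open Scope ring_scope.

(* Components are indexed by 'I_2, so the 1-based index k = 1, 2 of the
   mathematical notation is shifted: component 1 is ord0, component 2 is
   ord_max. *)
Notation k1 := (ord0 : 'I_2).
Notation k2 := (ord_max : 'I_2).

Record gas_constants (R : realType) := GasConstants {
  cVk : 'I_2 -> R;
  gammak : 'I_2 -> R;
  pstar : 'I_2 -> R;
  eps0k : 'I_2 -> R;
  cVk_gt0 : forall k, 0 < cVk k;
  gammak_gt1 : forall k, 1 < gammak k;
  pstar_ge0 : forall k, 0 <= pstar k
}.

Definition Rk (R : realType) (G : gas_constants R) (k : 'I_2) : R :=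
  (gammak G k - 1) * cVk G k.

Record mixture_state (R : realType) (G : gas_constants R) := MixtureState {
  dens : 'I_2 -> R;
  alpha : 'I_2 -> R;
  theta : R;
  pressure : R;
  dens_gt0 : forall k, 0 < dens k;
  alpha_gt0 : forall k, 0 < alpha k;
  alpha_lt1 : forall k, alpha k < 1;
  alpha_sum : alpha k1 + alpha k2 = 1;
  theta_gt0 : 0 < theta;
  pressure_eq : forall k, Rk G k * dens k * theta - pstar G k = pressure;
  pressure_gt0 : 0 < pressure
}.

Section MixtureQuantities.
Context (R : realType) (G : gas_constants R) (S : mixture_state G).
Implicit Types k : 'I_2.

Definition epsk k : R :=
  cVk G k * theta S + pstar G k / dens S k + eps0k G k.

Definition rhok k : R := alpha S k * dens S k.

Definition rho : R := \sum_(k < 2) rhok k.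

(* The mixture quantities below are introduced through identities of the form
   rho * q = \sum_k ...; as rho > 0, this amounts to dividing by rho. *)
Definition eps : R := (\sum_(k < 2) rhok k * epsk k) / rho.
Definition eps0 : R := (\sum_(k < 2) rhok k * eps0k G k) / rho.
Definition Rmix : R := (\sum_(k < 2) Rk G k * rhok k) / rho.
Definition cV : R := (\sum_(k < 2) cVk G k * rhok k) / rho.

Definition gamma : R := Rmix / cV + 1.

Definition sigma k : R := Rk G k * rhok k / (cV * rho).

Definition b : R :=
  \sum_(k < 2)
    (sigma k * (rho * (eps - eps0) - pstar G k) - pstar G k).

Definition c : R :=
  (sigma k1 * pstar G k2 + sigma k2 * pstar G k1) * (rho * (eps - eps0))
  - gamma * pstar G k1 * pstar G k2.

Definition d : R := b ^+ 2 + 4 * c.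

Definition ak k : R := sigma k * (rho * (eps - eps0) - pstar G k).
Definition bk k : R := ak k - pstar G k.

Definition Delta_star : R := pstar G k2 - pstar G k1.

End MixtureQuantities.

(* Main.v *)
Require Import Defs.
From mathcomp Require Import all_boot all_order all_algebra.
From mathcomp Require Import reals.
From mathcomp Require Import ring.

Import Order.TTheory GRing.Theory Num.Theory.
Local Open Scope ring_scope.

(** Write E for rho (eps - eps0), w for c_V rho theta and Delta for
    p_{*2} - p_{*1}.  Two facts about a mixture state drive the proof.  The
    coefficients sigma^(k) add up to gamma - 1 ([gamma_sigma]), and
    E = w + alpha_1 p_{*1} + alpha_2 p_{*2} ([internal_energyE]), because
    rho_k / r_k = alpha_k.  As alpha_1 + alpha_2 = 1, the latter gives
    E - p_{*1} = w + alpha_2 Delta and E - p_{*2} = w - alpha_1 Delta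
    ([ak1E], [ak2E]).

    By the first fact, c = a_1 a_2 - b_1 b_2, while b = b_1 + b_2; hence
    d = (b_1 - b_2)^2 + 4 a_1 a_2 ([discriminantE]).  Since
    b_1 - b_2 = a_1 - a_2 + Delta, this reads
    d = (a_1 + a_2)^2 + 2 (a_1 - a_2) Delta + Delta^2, and a_1 + a_2 and
    a_1 - a_2 are affine in Delta, which yields the quadratic polynomial.

    For the sign, complete the square in either of two ways:
    d = (a_1 + a_2 - Delta)^2 + 4 a_1 Delta
      = (a_1 + a_2 + Delta)^2 - 4 a_2 Delta.
    Although a_1 and a_2 need not both be positive, a_1 > 0 when
    Delta >= 0 and a_2 > 0 when Delta <= 0, so one of the two forms is a
    sum of nonnegative terms.  The last term is positive unless Delta = 0,
    and then d = (a_1 + a_2)^2 with both a_k positive. *)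

Lemma sum_components (V : nmodType) (F : 'I_2 -> V) :
  \sum_(k < 2) F k = F k1 + F k2.
Proof.
by rewrite big_ord_recl big_ord1; congr (_ + F _); apply/val_inj.
Qed.

Section MixtureState.
Context (R : realType) (G : gas_constants R) (S : mixture_state G).

Lemma Rk_gt0 k : 0 < Rk G k.
Proof. by rewrite mulr_gt0 ?subr_gt0 ?gammak_gt1 ?cVk_gt0. Qed.

Lemma rhok_gt0 k : 0 < rhok S k.
Proof. by rewrite mulr_gt0 ?alpha_gt0 ?dens_gt0. Qed.

Lemma rho_gt0 : 0 < rho S.
Proof. by rewrite /rho sum_components addr_gt0 ?rhok_gt0. Qed.

Lemma cV_gt0 : 0 < cV S.
Proof.
rewrite divr_gt0 ?rho_gt0 // sum_components.
by rewrite addr_gt0 // mulr_gt0 ?cVk_gt0 ?rhok_gt0.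
Qed.

Lemma sigma_gt0 k : 0 < sigma S k.
Proof.
exact: divr_gt0 (mulr_gt0 (Rk_gt0 k) (rhok_gt0 k)) (mulr_gt0 cV_gt0 rho_gt0).
Qed.

Lemma thermal_energy_gt0 : 0 < cV S * rho S * theta S.
Proof. exact: mulr_gt0 (mulr_gt0 cV_gt0 rho_gt0) (theta_gt0 S). Qed.

Lemma gamma_sigma : gamma S = sigma S k1 + sigma S k2 + 1.
Proof.
rewrite /gamma /Rmix /sigma sum_components -mulrDl.
by rewrite -mulrA -invfM [rho S * cV S]mulrC.
Qed.

(** The term p_{*k} / r_k of the specific energy contributes p_{*k} per unit
    volume of component k, since rho_k / r_k = alpha_k. *)
Lemma internal_energyE :
  rho S * (eps S - eps0 S)
  = cV S * rho S * theta S + alpha S k1 * pstar G k1 + alpha S k2 * pstar G k2.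
Proof.
have rho_n0 := lt0r_neq0 rho_gt0.
have r1_n0 := lt0r_neq0 (dens_gt0 S k1).
have r2_n0 := lt0r_neq0 (dens_gt0 S k2).
rewrite /eps /eps0 /cV mulrBr !(mulrC (rho S)) !divfK // !sum_components.
by rewrite /epsk /rhok; field; rewrite r1_n0 r2_n0.
Qed.

Lemma ak1E :
  ak S k1
  = sigma S k1 * (cV S * rho S * theta S + alpha S k2 * Delta_star G).
Proof.
rewrite /ak internal_energyE /Delta_star.
have -> : alpha S k2 = 1 - alpha S k1 by rewrite -(alpha_sum S) addrC addKr.
by ring.
Qed.

Lemma ak2E :
  ak S k2
  = sigma S k2 * (cV S * rho S * theta S - alpha S k1 * Delta_star G).
Proof.
rewrite /ak internal_energyE /Delta_star.
have -> : alpha S k2 = 1 - alpha S k1 by rewrite -(alpha_sum S) addrC addKr.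
by ring.
Qed.

Lemma ak1_gt0 : 0 <= Delta_star G -> 0 < ak S k1.
Proof.
move=> D_ge0; rewrite ak1E mulr_gt0 ?sigma_gt0 //.
by rewrite ltr_wpDr ?thermal_energy_gt0 // mulr_ge0 // ltW ?alpha_gt0.
Qed.

Lemma ak2_gt0 : Delta_star G <= 0 -> 0 < ak S k2.
Proof.
move=> D_le0; rewrite ak2E mulr_gt0 ?sigma_gt0 // -mulrN.
rewrite ltr_wpDr ?thermal_energy_gt0 // mulr_ge0 ?oppr_ge0 //.
by rewrite ltW ?alpha_gt0.
Qed.

(** Equivalent to c = a_1 a_2 - b_1 b_2: the product p_{*1} p_{*2} occurs in
    a_1 a_2 - b_1 b_2 with coefficient - (sigma^(1) + sigma^(2) + 1), which is
    - gamma. *)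
Lemma discriminantE :
  d S = (bk S k1 - bk S k2) ^+ 2 + 4 * ak S k1 * ak S k2.
Proof.
rewrite /d /b /c sum_components gamma_sigma /bk /ak.
by ring.
Qed.

Lemma discriminant_Delta :
  d S = (ak S k1 + ak S k2) ^+ 2
        + 2 * (ak S k1 - ak S k2) * Delta_star G + Delta_star G ^+ 2.
Proof. by rewrite discriminantE /bk /Delta_star; ring. Qed.

Lemma discriminant_gt0 : 0 < d S.
Proof.
rewrite discriminant_Delta.
move: ak1_gt0 ak2_gt0.
move: (ak S k1) (ak S k2) (Delta_star G) => a1 a2 D a1_gt0 a2_gt0.
case: (ltrgtP D 0) => [D_lt0|D_gt0|D0].
- have -> : (a1 + a2) ^+ 2 + 2 * (a1 - a2) * D + D ^+ 2
            = (a1 + a2 + D) ^+ 2 + 4 * a2 * - D by ring.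
  by rewrite ltr_wpDl ?sqr_ge0 // !mulr_gt0 ?oppr_gt0 // a2_gt0 ?ltW.
- have -> : (a1 + a2) ^+ 2 + 2 * (a1 - a2) * D + D ^+ 2
            = (a1 + a2 - D) ^+ 2 + 4 * a1 * D by ring.
  by rewrite ltr_wpDl ?sqr_ge0 // !mulr_gt0 // a1_gt0 ?ltW.
- rewrite D0 mulr0 expr0n /= !addr0 exprn_gt0 //.
  by rewrite addr_gt0 ?a1_gt0 ?a2_gt0 ?D0.
Qed.

End MixtureState.

Theorem proposition2 (R : realType) (G : gas_constants R)
    (S : mixture_state G) :
  [/\ d S = (bk S k1 - bk S k2) ^+ 2 + 4 * ak S k1 * ak S k2,
      d S =
        ((alpha S k2 * sigma S k1 - alpha S k1 * sigma S k2) ^+ 2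
         + 2 * (alpha S k1 * sigma S k2 + alpha S k2 * sigma S k1) + 1)
          * Delta_star G ^+ 2
        + 2 * cV S * rho S * theta S
          * ((alpha S k2 * sigma S k1 - alpha S k1 * sigma S k2)
               * (gamma S - 1)
             + sigma S k1 - sigma S k2)
          * Delta_star G
        + ((gamma S - 1) * cV S * rho S * theta S) ^+ 2
    & 0 < d S].
Proof.
split; [exact: discriminantE | | exact: discriminant_gt0].
by rewrite discriminant_Delta ak1E ak2E gamma_sigma; ring.
Qed.
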